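(* $\mathrm{IBDer}(L_1)=\mathrm{BDer}(L_1)$; that is, every biderivation of $L_1$ is inner.
   Context: The ground field $\mathbb{F}$ is algebraically closed of characteristic zero. $L_1$ is the $\mathbb{N}$-graded Lie algebra over $\mathbb{F}$ with basis $\{e_i\mid i\geq 1\}$, $e_i$ homogeneous of degree $i$, and brackets $[e_i,e_j]=(j-i)e_{i+j}$ for all $i,j\geq 1$. A derivation of a Lie algebra $\mathfrak{g}$ is a linear map $D:\mathfrak{g}\to\mathfrak{g}$ with $D([x,y])=[D(x),y]+[x,D(y)]$ for all $x,y$. A biderivation of $\mathfrak{g}$ is a skew-symmetric ($f(x,y)=-f(y,x)$) bilinear map $f:\mathfrak{g}\times\mathfrak{g}\to\mathfrak{g}$ such that for every $x\in\mathfrak{g}$ both maps $y\mapsto f(x,y)$ and $y\mapsto f(y,x)$ are derivations of $\mathfrak{g}$; $\mathrm{BDer}(\mathfrak{g})$ is the set of biderivations. An inner biderivation is a map of the form $f_\lambda(x,y)=\lambda[x,y]$ for some $\lambda\in\mathbb{F}$; $\mathrm{IBDer}(\mathfrak{g})$ is the set of inner biderivations. *)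

(* Defs.v *)
From HB Require Import structures.
From mathcomp Require Import all_boot all_order all_algebra ring.
From mathcomp Require Import mathcomp_extra boolp classical_sets.

Set Implicit Arguments.
Unset Strict Implicit.
Unset Printing Implicit Defensive.

Import GRing.Theory.

Local Open Scope ring_scope.
Local Open Scope classical_set_scope.

HB.mixin Record Lmodule_isLie (F : fieldType) L of GRing.Lmodule F L := {
  lie : L -> L -> L;
  lie_bilinear : bilinear_for *:%R *:%R lie;
  liexx : forall x : L, lie x x = 0;
  lie_jacobi : forall x y z : L,
    lie x (lie y z) + lie y (lie z x) + lie z (lie x y) = 0
}.

#[short(type="lieAlgType")]
HB.structure Definition LieAlgebra (F : fieldType) :=
  {L of GRing.Lmodule F L & Lmodule_isLie F L}.

Section Biderivations.
Variables (F : fieldType) (L : lieAlgType F).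

Definition derivation (D : L -> L) : Prop :=
  linear D /\ forall x y : L, D (lie x y) = lie (D x) y + lie x (D y).

Definition biderivation (f : L -> L -> L) : Prop :=
  [/\ bilinear_for *:%R *:%R f,
      forall x y : L, f x y = - f y x
    & forall x : L, derivation (fun y => f x y) /\ derivation (fun y => f y x)].

Definition inner_map (lambda : F) (x y : L) : L := lambda *: lie x y.

Definition BDer : set (L -> L -> L) := [set f | biderivation f].

Definition IBDer : set (L -> L -> L) := range inner_map.

End Biderivations.

Arguments BDer {F} L.
Arguments IBDer {F} L.

(* The underlying space of L_1 is that of finitely supported sequences of
   scalars, encoded as polynomials: e_i is 'X^(i - 1) for i >= 1, so the
   coefficient p`_k is the coordinate of p on e_(k+1).  The Lie algebra structure
   below is defined without the product of polynomials. *)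
Definition L1 (F : fieldType) : Type := {poly F}.

HB.instance Definition _ (F : fieldType) := GRing.Lmodule.on (L1 F).

(* Meaningful for i >= 1 only (the value at 0 is junk). *)
Definition L1_e (F : fieldType) (i : nat) : L1 F := 'X^(i.-1).

(* The bilinear extension of [e_i, e_j] = (j - i) e_(i+j). *)
Definition L1_lie (F : fieldType) (p q : L1 F) : L1 F :=
  \sum_(i < size (p : {poly F})) \sum_(j < size (q : {poly F}))
    ((p : {poly F})`_i * (q : {poly F})`_j * (j.+1%:R - i.+1%:R))
      *: L1_e F (i.+1 + j.+1).

Section L1Theory.
Variable F : fieldType.

(* Thinking of e_i as the vector field x^(i+1) d/dx, i.e. of p as x^2 p d/dx. *)
Lemma L1_lieE (p q : {poly F}) :
  L1_lie p q = 'X^2 * (p * q^`() - p^`() * q) :> {poly F}.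
Proof.
have PE (r : {poly F}) : r = \sum_(i < size r) r`_i *: 'X^i.
  by rewrite -poly_def coefK.
have DE (r : {poly F}) :
    r^`() * 'X = \sum_(i < size r) (r`_i * i%:R) *: 'X^i.
  rewrite {1}[r]PE raddf_sum mulr_suml; apply: eq_bigr => i _ /=.
  rewrite derivZ derivXn -scalerAl -scalerA scaler_nat mulrnAl.
  by case: (i : nat) => [|k]; rewrite ?mulr0n // -exprSr.
transitivity ('X * (p * (q^`() * 'X) - (p^`() * 'X) * q)); last by ring.
rewrite !DE [X in X * _ - _]PE [X in _ - _ * X]PE !big_distrlr /=.
rewrite -sumrB mulr_sumr.
apply: eq_bigr => i _; rewrite -sumrB mulr_sumr; apply: eq_bigr => j _.
rewrite /L1_e addSn addnS /= -!scalerAl -!scalerAr !scalerA -scalerBl.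
rewrite -exprD -scalerAr -exprS; congr (_ *: _).
by rewrite -!natr1; ring.
Qed.

Lemma L1_lie_bilinear : bilinear_for *:%R *:%R (@L1_lie F).
Proof.
have lieP (a : F) (p q r : {poly F}) :
    'X^2 * ((a *: p + q) * r^`() - (a *: p + q)^`() * r)
    = a *: ('X^2 * (p * r^`() - p^`() * r)) + 'X^2 * (q * r^`() - q^`() * r).
  by rewrite derivD derivZ -!mul_polyC; ring.
have liePr (a : F) (p q r : {poly F}) :
    'X^2 * (r * (a *: p + q)^`() - r^`() * (a *: p + q))
    = a *: ('X^2 * (r * p^`() - r^`() * p)) + 'X^2 * (r * q^`() - r^`() * q).
  by rewrite derivD derivZ -!mul_polyC; ring.
by split=> [q a p1 p2|p a q1 q2]; rewrite !L1_lieE; [exact: lieP|exact: liePr].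
Qed.

Lemma L1_liexx (p : L1 F) : L1_lie p p = 0.
Proof.
have lie0 (r : {poly F}) : 'X^2 * (r * r^`() - r^`() * r) = 0 by ring.
by rewrite L1_lieE; exact: lie0.
Qed.

Lemma L1_lie_jacobi (p q r : L1 F) :
  L1_lie p (L1_lie q r) + L1_lie q (L1_lie r p) + L1_lie r (L1_lie p q) = 0.
Proof.
have jacobi (u v w : {poly F}) (b := fun x y => 'X^2 * (x * y^`() - x^`() * y)) :
    b u (b v w) + b v (b w u) + b w (b u v) = 0.
  by rewrite /b !(derivM, derivB, derivXn) /= !expr1; ring.
by rewrite !L1_lieE; exact: jacobi.
Qed.

HB.instance Definition _ := Lmodule_isLie.Build F (L1 F)
  L1_lie_bilinear L1_liexx L1_lie_jacobi.

Lemma lie_L1_e (i j : nat) : (0 < i)%N -> (0 < j)%N ->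
  lie (L1_e F i) (L1_e F j) = (j%:R - i%:R) *: L1_e F (i + j).
Proof.
case: i j => [//|i] [//|j] _ _; rewrite /lie /= /L1_lie /L1_e /= !size_polyXn.
rewrite (bigD1 ord_max) //= [X in _ + X]big1 ?addr0 => [|k kn]; last first.
  apply: big1 => l _; rewrite coefXn.
  by rewrite -[_ == _]/(k == ord_max) (negPf kn) !mul0r scale0r.
rewrite (bigD1 ord_max) //= [X in _ + X]big1 ?addr0 => [|k kn]; last first.
  by rewrite !coefXn -[k == j :> nat]/(k == ord_max) (negPf kn) mulr0 mul0r scale0r.
by rewrite !coefXn !eqxx !mul1r.
Qed.

Lemma L1_e_span (x : L1 F) :
  x = \sum_(i < size (x : {poly F})) (x : {poly F})`_i *: L1_e F i.+1.
Proof. by rewrite -[LHS](coefK (x : {poly F})) poly_def. Qed.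

Lemma L1_e_free (n : nat) (c : 'I_n -> F) :
  \sum_(i < n) c i *: L1_e F i.+1 = 0 -> forall i, c i = 0.
Proof.
move=> /(congr1 (fun x : {poly F} => x`_ _)) c0 i; move: (c0 i).
rewrite coef_sum coef0 (bigD1 i) //= big1 ?addr0 => [|j ji].
  by rewrite coefZ coefXn eqxx mulr1.
by rewrite coefZ coefXn -[i == j :> nat]/(i == j) eq_sym (negPf ji) mulr0.
Qed.

End L1Theory.

(* Main.v *)
(** Computing f([x,u],[y,v]) in two ways shows that a biderivation f of a Lie
    algebra satisfies [f(x,y), [u,v]] = [[x,y], f(u,v)] (characteristic not 2).
    In L_1 the centralizer of e_i is spanned by e_i.  Taking x = u and y = v, the
    identity gives f(e_1,e_2) = l [e_1,e_2] and f(e_1,e_3) = m [e_1,e_3]; taking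
    then (u, v) = (e_1, e_2) and (u, v) = (e_1, e_3), it shows that
    f(x,y) - l [x,y] is a multiple of e_3 and that f(x,y) - m [x,y] is a
    multiple of e_4.  Evaluating at (e_1, e_2) forces l = m, whence
    f(x,y) = l [x,y]. *)
Require Import Defs.
From mathcomp Require Import all_boot all_order all_algebra.
From mathcomp Require Import classical_sets.
From mathcomp Require Import boolp.

Set Implicit Arguments.
Unset Strict Implicit.
Unset Printing Implicit Defensive.

Import GRing.Theory.

Local Open Scope ring_scope.

Section LieAlgebraTheory.
Variables (F : fieldType) (L : lieAlgType F).
Implicit Types x y z : L.

Lemma lieDl x y z : lie (x + y) z = lie x z + lie y z.
Proof.
by have [/(_ z 1 x y) + _] := lie_bilinear (s := L); rewrite /= !scale1r.
Qed.

Lemma lieDr x y z : lie z (x + y) = lie z x + lie z y.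
Proof.
by have [_ /(_ z 1 x y)] := lie_bilinear (s := L); rewrite /= !scale1r.
Qed.

Lemma lie0r x : lie x 0 = 0.
Proof. by apply: (addrI (lie x 0)); rewrite -lieDr !addr0. Qed.

Lemma lieZr a x y : lie x (a *: y) = a *: lie x y.
Proof.
by have [_ /(_ x a y 0)] := lie_bilinear (s := L); rewrite /= addr0 lie0r addr0.
Qed.

Lemma lie_antisym x y : lie x y = - lie y x.
Proof.
apply/eqP; rewrite -addr_eq0; apply/eqP.
by have := liexx (x + y); rewrite lieDl !lieDr !liexx add0r addr0.
Qed.

Lemma lieNr x y : lie x (- y) = - lie x y.
Proof. by rewrite -!scaleN1r lieZr. Qed.

Lemma lieNl x y : lie (- x) y = - lie x y.
Proof. by rewrite lie_antisym lieNr -lie_antisym. Qed.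

Lemma lieZl a x y : lie (a *: x) y = a *: lie x y.
Proof. by rewrite lie_antisym lieZr -scalerN -lie_antisym. Qed.

Lemma lie_lier x y z : lie x (lie y z) = lie (lie x y) z + lie y (lie x z).
Proof.
have /eqP := lie_jacobi x y z; rewrite -addrA addr_eq0 => /eqP ->.
by rewrite opprD (lie_antisym (lie x y)) (lie_antisym x z) lieNr addrC.
Qed.

Lemma lie_lierl x y z : lie (lie x y) z = lie x (lie y z) - lie y (lie x z).
Proof. by rewrite lie_lier addrK. Qed.

(** The Jacobi identity in Leibniz form gives the rule in the second argument; antisymmetry carries
    it over to the first. *)
Lemma inner_biderivation a : biderivation (@inner_map F L a).
Proof.
rewrite /inner_map; split.
- by split=> [z b x y|z b x y] /=;
    rewrite (lieDl, lieDr) (lieZl, lieZr) scalerDr !scalerA mulrC.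
- by move=> x y; rewrite lie_antisym scalerN.
- move=> x; split; split=> [b y z|y z].
  + by rewrite lieDr lieZr scalerDr !scalerA mulrC.
  + by rewrite lie_lier scalerDr lieZl lieZr.
  + by rewrite lieDl lieZl scalerDr !scalerA mulrC.
  + rewrite (lie_antisym (lie y z)) lie_lier (lie_antisym y x) (lie_antisym z x).
    by rewrite lieZl lieZr lieNl lieNr -scalerDr opprD.
Qed.

Section Identity.
Variable f : L -> L -> L.
Hypothesis f_bider : biderivation f.

(** The defect of the identity to be proved; the symmetries of [phi] will force it to vanish. *)
Let phi x y u v := lie (f x y) (lie u v) - lie (lie x y) (f u v).

Lemma biderivation_lie_swap x y u v : phi x y u v = phi x v u y.
Proof.
have [_ _ fD] := f_bider.
have fr z a b : f z (lie a b) = lie (f z a) b + lie a (f z b).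
  by have [[_ /(_ a b)]] := fD z.
have fl z a b : f (lie a b) z = lie (f a z) b + lie a (f b z).
  by have [_ [_ /(_ a b)]] := fD z.
(* [fE] equates the two expansions of f([x,u],[y,v]): second argument first on the left, first
   argument first on the right. *)
have := fl (lie y v) x u; rewrite fr !fl !fr !(lieDl, lieDr) /phi => fE.
(* Jacobi splits the four double brackets of the goal into the eight terms of [fE]. *)
rewrite (lie_lier (f x y) u) (lie_antisym u (lie _ v)) (lie_lierl x y).
rewrite (lie_lier (f x v) u) (lie_antisym (lie _ u) y).
rewrite (lie_antisym (f x v) y) lieNr -(lie_antisym _ u) (lie_lierl x v).
rewrite (lie_antisym v (f u y)) lieNr (lie_antisym v (lie x _)) opprK.
apply/eqP; rewrite -subr_eq0 !opprD !opprK.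
rewrite (AC ((2*2)*(2*2)) ((1*8*(5*4))*(2*6*(7*3)))) /= -!opprD subr_eq0.
exact/eqP.
Qed.

Lemma biderivation_lie_comm x y u v : (2%:R : F) != 0 ->
  lie (f x y) (lie u v) = lie (lie x y) (f u v).
Proof.
move=> two_neq0; have [_ fC _] := f_bider.
have phiC a b c d : phi a b c d = - phi b a c d.
  by rewrite /phi fC (lie_antisym a b) !lieNl opprD.
apply/eqP; rewrite -subr_eq0 -/(phi x y u v).
(* [phi] is invariant under the transposition (y v) but changes sign under
   (x y); these are conjugate in the permutations of x, y, v. *)
have phi2 : phi x y u v = - phi x y u v.
  rewrite {1}biderivation_lie_swap phiC biderivation_lie_swap phiC opprK.
  by rewrite biderivation_lie_swap phiC.
have : 2%:R *: phi x y u v = 0 by rewrite scaler_nat mulr2n {1}phi2 addNr.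
by move/eqP; rewrite scaler_eq0 (negPf two_neq0).
Qed.

(** At u = x, v = y the identity makes this bracket its own negative. *)
Lemma biderivation_lie_self x y : (2%:R : F) != 0 ->
  lie (f x y) (lie x y) = 0.
Proof.
move=> two_neq0; have := biderivation_lie_comm x y x y two_neq0.
rewrite (lie_antisym (lie x y)) => /eqP; rewrite -addr_eq0 -mulr2n.
by rewrite -scaler_nat scaler_eq0 (negPf two_neq0) => /eqP.
Qed.

End Identity.
End LieAlgebraTheory.

Section L1Biderivations.
Variable F : fieldType.
Hypothesis charF0 : [pchar F] =i pred0.

Lemma eqr_nat_pchar0 m n : (m%:R == n%:R :> F) = (m == n).
Proof.
wlog le_mn : m n / (m <= n)%N.
  by case/orP: (leq_total m n) => ? H; [|rewrite eq_sym (eq_sym m)]; apply: H.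
rewrite eq_sym -subr_eq0 -natrB // ((pcharf0P F).1 charF0) subn_eq0.
by rewrite eqn_leq le_mn.
Qed.

(** With i = n + 1 and x read as a polynomial p, commuting with X^n means n p = X p'.
    Coefficientwise, (n - k) p_k = 0, so only p_n survives in characteristic zero. *)
Lemma L1_e_centralizer i (x : L1 F) : (0 < i)%N ->
  lie x (L1_e F i) = 0 -> exists c, x = c *: L1_e F i.
Proof.
case: i => // n _; rewrite [lie _ _]L1_lieE /L1_e /=.
set p : {poly F} := x => /eqP; rewrite mulf_eq0 expf_eq0 /= polyX_eq0 /=.
rewrite subr_eq0 => /eqP pe.
have {}pe : p *+ n = p^`() * 'X.
  apply: (mulIf (expf_neq0 n (negbT (polyX_eq0 F)))).
  rewrite -mulrA (mulrC 'X) mulrA -pe derivXn -mulrA mulrnAl mulrnAl -mulrnAr.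
  (* At n = 0 the truncated exponent [n.-1] is harmless, since its factor n vanishes. *)
  by case: n {pe} => [|n]; rewrite ?mulr0n // -exprSr.
exists p`_n; apply/polyP => k; rewrite coefZ coefXn.
have [->|kn] := eqVneq k n; first by rewrite mulr1.
have := congr1 (fun q : {poly F} => q`_k) pe.
rewrite coefMn coefMX coef_deriv.
have -> : (if k == 0%N then 0 else p`_k.-1.+1 *+ k.-1.+1) = p`_k *+ k.
  by case: k {kn}.
rewrite mulr0 -!(mulr_natr p`_k) => /eqP.
rewrite -subr_eq0 -mulrBr mulf_eq0 subr_eq0 => /orP[/eqP //|].
by rewrite eq_sym eqr_nat_pchar0 (negPf kn).
Qed.

Lemma L1_biderivation_inner_mod f u v i c : biderivation f -> (0 < i)%N ->
    c != 0 -> lie u v = c *: L1_e F i ->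
  exists l, f u v = l *: lie u v /\
    forall x y, exists d, f x y - l *: lie x y = d *: L1_e F i.
Proof.
move=> f_bider i_gt0 c_neq0 uvE.
have two_neq0 : (2%:R : F) != 0 by rewrite ((pcharf0P F).1 charF0).
have central w : lie w (lie u v) = 0 -> exists d, w = d *: L1_e F i.
  rewrite uvE lieZr => /eqP; rewrite scaler_eq0 (negPf c_neq0) => /eqP.
  exact: L1_e_centralizer.
have [l fuv] := central _ (biderivation_lie_self f_bider u v two_neq0).
(* Dividing by c turns a multiple of e_i into a multiple of [u,v]. *)
have {}fuv : f u v = (l / c) *: lie u v by rewrite uvE scalerA divfK.
exists (l / c); split=> // x y; apply: central.
(* With k = l / c, [f(x,y) - k [x,y], [u,v]] = [[x,y], f(u,v) - k [u,v]] = 0. *)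
rewrite lieDl lieNl lieZl (biderivation_lie_comm f_bider) // fuv lieZr.
exact: subrr.
Qed.

Lemma L1_e_indep i j c d : (0 < i)%N -> (0 < j)%N -> i != j ->
  c *: L1_e F i = d *: L1_e F j -> c = 0.
Proof.
case: i j => [|i] [|j] // _ _; rewrite eqSS => ij.
move=> /(congr1 (fun p : {poly F} => p`_i)).
by rewrite /L1_e /= !coefZ !coefXn eqxx (negPf ij) mulr1 mulr0.
Qed.

End L1Biderivations.

Theorem theorem3p1 (F : closedFieldType) (charF0 : [pchar F] =i pred0) :
  IBDer (L1 F) = BDer (L1 F).
Proof.
apply/seteqP; split=> [_ [a _ <-]|f f_bider]; first exact: inner_biderivation.
have two_neq0 : (2%:R : F) != 0 by rewrite ((pcharf0P F).1 charF0).
have lie12 : lie (L1_e F 1) (L1_e F 2) = 1 *: L1_e F 3.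
  by rewrite lie_L1_e // -natrB.
have lie13 : lie (L1_e F 1) (L1_e F 3) = 2%:R *: L1_e F 4.
  by rewrite lie_L1_e // -natrB.
have [l [f12 f3]] :=
  L1_biderivation_inner_mod (i := 3) charF0 f_bider isT (oner_neq0 F) lie12.
have [m [_ f4]] :=
  L1_biderivation_inner_mod (i := 4) charF0 f_bider isT two_neq0 lie13.
have lm : l = m.
  (* Here [f4] says that (l - m) e_3 is a multiple of e_4. *)
  have [d] := f4 (L1_e F 1) (L1_e F 2).
  rewrite f12 -scalerBl lie12 scale1r => /L1_e_indep lm.
  by apply/eqP; rewrite -subr_eq0 lm.
exists l => //; apply/funext => x; apply/funext => y.
(* The difference f(x,y) - l [x,y] lies on the lines of both e_3 and e_4, hence is zero. *)
have [c fxy] := f3 x y; have [d] := f4 x y.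
rewrite -lm fxy => /L1_e_indep c0; move/eqP: fxy.
by rewrite c0 // scale0r subr_eq0 => /eqP ->.
Qed.
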